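(* As $n \to \infty$, $$\mathbb{P}\left[\left\{\mathbf{b} \in \mathcal{M}_n : \mathcal{A}_n(\mathbf{b}) \text{ synchronizes}\right\}\right] = 1 - O\left(\frac{1}{n}\right).$$ Thus a randomly chosen $\mathcal{A}_n(\mathbf{b})$ synchronizes with high probability (i.e. with probability tending to $1$) as $n\to\infty$.
   Context: For a positive integer $n$ let $\mathbb{Z}_n := \{0,1,\ldots,n-1\}$ and $(r)_n := r \bmod n \in \mathbb{Z}_n$. $\mathcal{M}_n$ is the set of all mappings $\mathbf{b}:\mathbb{Z}_n\to\mathbb{Z}_n$, written as vectors $\mathbf{b}=(b_0,\ldots,b_{n-1})$ with $b_i=\mathbf{b}(i)$; $\mathbb{P}$ is the uniform probability measure on $\mathcal{M}_n$. A complete deterministic finite automaton is a pair $(Q,L)$, where $Q$ is a finite set of states and $L$ is a finite set of mappings $Q\to Q$ (letters). A word $\mathbf{w}=\mathbf{a}_{1}\mathbf{a}_{2}\cdots\mathbf{a}_{r}$ over $L$ acts on $Q$ by applying its letters successively: $q\mathbf{w} = (\cdots((q\mathbf{a}_1)\mathbf{a}_2)\cdots)\mathbf{a}_r$. The automaton synchronizes if there is a word $\mathbf{w}$ over $L$ acting on $Q$ as a constant mapping, i.e. $q\mathbf{w}=q'\mathbf{w}$ for all $q,q'\in Q$. $\mathcal{A}_n(\mathbf{b}) := (\mathbb{Z}_n,\{\mathbf{a},\mathbf{b}\})$ is the automaton with state set $\mathbb{Z}_n$ and letters $\mathbf{a}$, $\mathbf{b}$, where $\mathbf{a}(i)=(i+1)_n$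 is the circular shift and $\mathbf{b}\in\mathcal{M}_n$. *)

(* Defs.v *)
From HB Require Import structures.
From mathcomp Require Import all_boot all_order all_algebra.
From mathcomp Require Import all_classical all_reals all_analysis.

Set Implicit Arguments.
Unset Strict Implicit.
Unset Printing Implicit Defensive.

Import Order.TTheory GRing.Theory Num.Theory.
Import numFieldNormedType.Exports.

Local Open Scope classical_set_scope.
Local Open Scope ring_scope.

Record automaton := Automaton {
  state : finType;
  letters : {set {ffun state -> state}} }.

(* Letters act on the right: the head of the word is applied first. *)
Definition word_act (Q : finType) (q : Q) (w : seq {ffun Q -> Q}) : Q :=
  foldl (fun (p : Q) (c : {ffun Q -> Q}) => c p) q w.

Definition synchronizes (A : automaton) : Prop :=
  exists w : seq {ffun state A -> state A},
    {subset w <= letters A} /\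
    forall q q' : state A, word_act q w = word_act q' w.

(* [ordS i] is the element of ['I_n] with value [i.+1 %% n]. *)
Definition circular_shift (n : nat) : {ffun 'I_n -> 'I_n} :=
  [ffun i => ordS i].

Definition shift_automaton (n : nat) (b : {ffun 'I_n -> 'I_n}) : automaton :=
  @Automaton 'I_n [set circular_shift n; b]%SET.

Definition unif_prob (R : realType) (T : finType) (E : set T) : R :=
  #|[set x : T | `[< E x >]]%SET|%:R / #|T|%:R.

Definition sync_prob (R : realType) (n : nat) : R :=
  unif_prob R [set b : {ffun 'I_n -> 'I_n} | synchronizes (shift_automaton b)].

(* Main.v *)
Require Import Defs.
From mathcomp Require Import all_boot all_order all_algebra.
From mathcomp Require Import all_classical all_reals all_analysis.
From mathcomp Require Import zify.
Import Order.TTheory GRing.Theory Num.Theory.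
Import numFieldNormedType.Exports.
Local Open Scope classical_set_scope.
Local Open Scope ring_scope.

(** Write n for the number of states.  An automaton synchronizes as soon as any
two of its states can be merged by some word ([synchronizes_mergeable]).  The
circular letter a moves a pair (i, i + d) to every other pair with the same
difference d, so what matters is which differences b can collapse.  The proof
only looks for merging words of the form a^s b a^r b: a pair with difference d
is merged when, for some position j, the difference g = b(j) - b(j - d) is a
collision shift of b, i.e. b(i) = b(i + g) for some i
([mergeable_avoids_shifts]).  Since a pair is unordered, it is enough to treat
0 < d <= n/2.

Let the n independent values of b be revealed from left to right.  The
collision shifts are read off the first half of the values only, and the
differences b(j) - b(j - d) off the second half, where b(j - d) is already
known because d <= n/2.  If k collision shifts are known at half time, each new
value b(j) must avoid k values, so a given d fails with probability at most
(1 - k/n)^(n/2) ([card_many_collision_shifts]).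

That the first half yields fewer than k collision shifts is unlikely too.  The
shifts would then all lie in a k-tuple t.  After j values with this property,
at least j/k distinct values have appeared, since a position is determined by
its value and by its shift from the first occurrence of that value
([size_undup_collision_shifts]).  A new value must either be fresh or be one of
the k values found at a distance listed in t, so at least j/k - k values are
forbidden ([card_few_collision_shifts]).

A union bound over the n shifts d and the n^k tuples t ends the proof: with k
of order log n, both kinds of failure have probability at most 1/n, because
n/k eventually dominates k log n.  All estimates are counts of words in
natural numbers; exponential decay is measured in powers of 2
([card_halving_tree]). *)

Set Implicit Arguments.
Unset Strict Implicit.
Unset Printing Implicit Defensive.

(** * Counting words along a prefix tree *)

Lemma bernoulli_expn (x q a : nat) :
  (x ^ a.+1 + a.+1 * q * x ^ a <= (x + q) ^ a.+1)%N.
Proof.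
elim: a => [|a IHa]; first by rewrite !expn1 expn0; lia.
rewrite [leqRHS]expnS; apply: leq_trans (leq_mul (leqnn _) IHa).
rewrite [(x ^ a.+2)%N]expnS [(x ^ a.+1)%N]expnS; nia.
Qed.

(** The only analytic input: [(1 - q/N)^a <= 1/2] once [a * q >= N], from
Bernoulli's inequality. *)
Lemma double_expn_subn (N q a : nat) :
  (0 < N)%N -> (q <= N)%N -> (N <= a * q)%N -> (2 * (N - q) ^ a <= N ^ a)%N.
Proof.
case: a => [|a] N0 qN Naq; first by lia.
rewrite -{2}(subnK qN); apply: leq_trans (bernoulli_expn _ _ _).
by rewrite mul2n -addnn leq_add2l expnS leq_mul2r; apply/orP; right; lia.
Qed.

(** Words all of whose prefixes satisfy [Q] are the leaves of a tree; [m j] bounds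
the branching at level [j]. *)
Lemma card_prefix_tree (T : finType) (Q : pred (seq T)) (m : nat -> nat) N :
  (forall w x, Q (rcons w x) -> Q w) ->
  (forall w, (size w < N)%N -> Q w ->
     (#|[pred x | Q (rcons w x)]| <= m (size w))%N) ->
  (#|[set w : N.-tuple T | Q w]%SET| <= \prod_(j < N) m j)%N.
Proof.
move=> Qpre; elim: N => [|N IHN] Qm.
  by rewrite big_ord0 -[leqRHS](expn0 #|T|) -card_tuple max_card.
rewrite big_ord_recr /=.
(* A word of length N + 1 is a word of length N and a last letter. *)
pose f (v : N.-tuple T * T) : N.+1.-tuple T := [tuple of rcons v.1 v.2].
have finj : injective f.
  move=> [v x] [v' x'] /(congr1 val) /= /rcons_inj [vv' ->].
  by congr (_, _); apply: val_inj.
have fbij : bijective f.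
  by apply: inj_card_bij finj _; rewrite card_prod !card_tuple expnS mulnC.
rewrite -sum1dep_card (reindex f) /=; last exact: onW_bij.
rewrite -(pair_big_dep xpredT (fun (v : N.-tuple T) x => Q (rcons v x))
  (fun _ _ => 1%N)) /=.
rewrite (bigID (fun v : N.-tuple T => Q v)) /= [X in (_ + X)%N]big1 ?addn0; last first.
  by move=> v nQv; rewrite big_pred0 // => x; apply: contraNF nQv => /Qpre.
apply: (@leq_trans (\sum_(v : N.-tuple T | Q v) m N)).
  apply: leq_sum => v Qv; rewrite sum1_card -{2}(size_tuple v).
  by apply: Qm => //; rewrite size_tuple.
rewrite sum_nat_const cardE -[size _]/(size (enum [pred v : N.-tuple T| Q v])) -cardE.
rewrite leq_mul2r; apply/orP; right.
rewrite -cardsE; apply: IHN => w sw; exact/Qm/ltnW.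
Qed.

(** Each run of [a] levels at which at least [q] letters are forbidden halves the
proportion of words that survive, and [s] such runs fit between the levels [u]
and [v]. *)
Lemma card_halving_tree (T : finType) (Q : pred (seq T)) (u v q a s N : nat) :
  (0 < #|T|)%N ->
  (forall w x, Q (rcons w x) -> Q w) ->
  (forall w, (u <= size w < v)%N -> Q w ->
     (#|[pred x | Q (rcons w x)]| <= #|T| - q)%N) ->
  (q <= #|T|)%N -> (#|T| <= a * q)%N -> (a * s <= v - u)%N -> (v <= N)%N ->
  (#|[set w : N.-tuple T | Q w]%SET| * 2 ^ s <= #|T| ^ N)%N.
Proof.
move=> T0 Qpre Qm qT Taq asuv vN.
pose m j := if (u <= j < v)%N then (#|T| - q)%N else #|T|.
have [vu|uv] := leqP v u.
  have -> : s = 0%N by case: a Taq asuv => [|a]; nia.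
  by rewrite muln1 -card_tuple max_card.
have tree : (#|[set w : N.-tuple T | Q w]%SET| <= \prod_(j < N) m j)%N.
  apply: card_prefix_tree => // w wN Qw; rewrite /m.
  by case: ifP => [/Qm/(_ Qw)//|_]; apply: max_card.
apply: leq_trans (leq_mul tree (leqnn _)) _.
have mE : (\prod_(j < N) m j = #|T| ^ (N - (v - u)) * (#|T| - q) ^ (v - u))%N.
  rewrite -(big_mkord xpredT) (@big_cat_nat _ _ _ u) //=; last by lia.
  rewrite (@big_cat_nat _ _ _ v u N) //=; last by lia.
  rewrite (@eq_big_nat _ _ _ 0 u _ (fun=> #|T|)); last first.
    by move=> i ?; rewrite /m ifF //; lia.
  rewrite (@eq_big_nat _ _ _ u v _ (fun=> #|T| - q)%N); last first.
    by move=> i ?; rewrite /m ifT.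
  rewrite (@eq_big_nat _ _ _ v N _ (fun=> #|T|)); last first.
    by move=> i ?; rewrite /m ifF //; lia.
  rewrite !prod_nat_const_nat mulnCA mulnC -expnD; congr (_ ^ _ * _)%N; lia.
rewrite mE -{2}(@subnK (v - u) N) ?expnD -?mulnA ?leq_mul2l; last by lia.
apply/orP; right.
rewrite -{1}(subnK asuv) -{2}(subnK asuv) !expnD -mulnA.
have expn_base x y e : (x <= y)%N -> (x ^ e <= y ^ e)%N.
  by case: e => // e xy; rewrite leq_exp2r.
apply: leq_mul; first by rewrite expn_base ?leq_subr.
by rewrite !expnM -expnMn mulnC expn_base ?double_expn_subn.
Qed.

(** * Shifts between equal letters of a word *)

(** The shift is not reduced modulo [p.+1]: both positions lie in [w], so that a
collision remains one when [w] is extended.  Shift 0 belongs to this set as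
soon as [w] is not empty. *)
Definition collision_shifts (p : nat) (w : seq 'I_p.+1) : {set 'I_p.+1} :=
  [set g : 'I_p.+1 | has (fun i => w`_i == w`_(i + g)) (iota 0 (size w - g))]%SET.

Lemma collision_shiftsP (p : nat) (w : seq 'I_p.+1) (g : 'I_p.+1) :
  reflect (exists2 i, (i + g < size w)%N & w`_i = w`_(i + g))
          (g \in collision_shifts w).
Proof.
rewrite inE; apply: (iffP hasP) => [[i]|[i ig e]].
  by rewrite mem_iota => ? /eqP; exists i => //; lia.
by exists i; [rewrite mem_iota; lia|apply/eqP].
Qed.

Lemma collision_shifts_cat (p : nat) (w v : seq 'I_p.+1) :
  collision_shifts w \subset collision_shifts (w ++ v).
Proof.
apply/fintype.subsetP => g /collision_shiftsP[i ig e].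
apply/collision_shiftsP; exists i; first by rewrite size_cat; lia.
have iw : (i < size w)%N by apply: leq_ltn_trans ig; rewrite leq_addr.
by rewrite !nth_cat ig iw.
Qed.

Lemma collision_shifts_take_rcons (p m : nat) (w : seq 'I_p.+1) x :
  collision_shifts (take m w) \subset collision_shifts (take m (rcons w x)).
Proof.
rewrite -cats1 take_cat; case: ltnP => // mw.
by rewrite take_oversize // collision_shifts_cat.
Qed.

(** A position is determined by its letter together with its shift from the first
occurrence of this letter, and that shift is a collision shift. *)
Lemma size_undup_collision_shifts (p k : nat) (w : seq 'I_p.+1)
    (t : k.-tuple 'I_p.+1) :
  (size w <= p.+1)%N -> {subset collision_shifts w <= t} ->
  (size w <= size (undup w) * k)%N.
Proof.
move=> wp wt.
have sub : {subset iota 0 (size w)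
    <= [seq (index x w + nat_of_ord g)%N | x <- undup w, g <- t]}.
  move=> i; rewrite mem_iota add0n => /andP[_ iw].
  have xw : w`_i \in w by exact: mem_nth.
  have ri : (index (w`_i)%R w <= i)%N by exact: index_nth.
  have gp : (i - index (w`_i)%R w < p.+1)%N by lia.
  apply/allpairsP; exists (w`_i, Ordinal gp) => /=; split.
  - by rewrite mem_undup.
  - apply: wt; apply/collision_shiftsP; exists (index (w`_i)%R w) => /=.
      by rewrite subnKC.
    by rewrite subnKC // nth_index.
  - by rewrite subnKC.
have := uniq_leq_size (iota_uniq _ _) sub.
by rewrite size_iota size_allpairs size_tuple.
Qed.

(** A letter that already occurs in [w] creates a collision with its first
occurrence, so it is one of the at most [k] letters at a distance listed
in [t]. *)
Lemma card_letters_collision_shifts (p k : nat) (w : seq 'I_p.+1)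
    (t : k.-tuple 'I_p.+1) :
  (size w < p.+1)%N ->
  (#|[pred x | collision_shifts (rcons w x) \subset t]|
     <= p.+1 - size (undup w) + k)%N.
Proof.
move=> wp.
pose old : seq 'I_p.+1 := [seq w`_(size w - nat_of_ord g) | g <- t].
have sub : [pred x | collision_shifts (rcons w x) \subset t]
    \subset [predU [predC undup w] & old].
  apply/fintype.subsetP => x; rewrite inE => /fintype.subsetP xt; rewrite !inE mem_undup.
  case: (boolP (x \in w)) => //= xw.
  have rw : (index x w < size w)%N by rewrite index_mem.
  have gp : (size w - index x w < p.+1)%N by lia.
  apply/mapP; exists (Ordinal gp) => /=; last by rewrite subKn ?nth_index // ltnW.
  apply: xt; apply/collision_shiftsP; exists (index x w) => /=.
    by rewrite size_rcons subnKC // ltnW.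
  by rewrite subnKC ?(ltnW rw) // !nth_rcons rw ltnn eqxx nth_index.
apply: leq_trans (subset_leq_card sub) _.
have := cardUI [predC undup w] (mem old); set U := #|_|; move=> UI.
have : (U <= #|[predC undup w]| + #|old|)%N by rewrite -UI leq_addr.
move/leq_trans; apply; apply: leq_add; last first.
  by apply: leq_trans (card_size _) _; rewrite size_map size_tuple.
have := cardC (mem (undup w)); rewrite card_ord (card_uniqP (undup_uniq w)).
by move=> /(canRL (addKn _)) /eq_leq.
Qed.

(** From level [u] on, [q + k] distinct letters have appeared; at most [k] of them
may be used again without creating a shift outside [t]. *)
Lemma card_few_collision_shifts (p k u v q a s : nat) (t : k.-tuple 'I_p.+1) :
  (0 < k)%N -> ((q + k) * k <= u <= v)%N -> (v <= p.+1)%N ->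
  (p.+1 <= a * q)%N -> (a * s <= v - u)%N ->
  (#|[set w : p.+1.-tuple 'I_p.+1 | collision_shifts (take v w) \subset t]%SET|
     * 2 ^ s <= p.+1 ^ p.+1)%N.
Proof.
move=> k0 /andP[qku uv] vp paq asuv.
rewrite -[X in (_ <= X ^ _)%N](card_ord p.+1).
apply: (@card_halving_tree _
  (fun w => collision_shifts (take v w) \subset t) u v q a) => //.
- by rewrite card_ord.
- move=> w x; apply: fintype.subset_trans.
  exact: collision_shifts_take_rcons.
- move=> w /andP[uw wv] wt; rewrite card_ord.
  have wp : (size w < p.+1)%N by exact: leq_trans vp.
  move: wt; rewrite take_oversize ?(ltnW wv)// => /fintype.subsetP wt.
  have wk := size_undup_collision_shifts (ltnW wp) wt.
  have qk : (q + k <= size (undup w))%N.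
    by rewrite -(leq_pmul2r k0) (leq_trans qku) // (leq_trans uw).
  apply: (@leq_trans #|[pred x | collision_shifts (rcons w x) \subset t]|).
    apply: subset_leq_card; apply/fintype.subsetP => x; rewrite !inE take_oversize //.
    by rewrite size_rcons.
  apply: leq_trans (card_letters_collision_shifts _ wp) _.
  have arith y : (q + k <= y)%N -> (y <= p.+1)%N -> (p.+1 - y + k <= p.+1 - q)%N by lia.
  apply: arith qk _.
  by rewrite -(card_uniqP (undup_uniq w)) -[leqRHS]card_ord max_card.
- rewrite card_ord (leq_trans _ (leq_trans qku (leq_trans uv vp))) //.
  exact: leq_trans (leq_addr k q) (leq_pmulr _ k0).
- by rewrite card_ord.
Qed.

(** Only the first [m] letters provide collision shifts and only later letters are
tested against them, so the letter [j >= m] is constrained by known data.  The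
truncated subtraction [j - d] is harmless because [d <= m] in all uses. *)
Definition avoids_shifts (p m d : nat) (w : seq 'I_p.+1) : bool :=
  all (fun j => w`_j - w`_(j - d) \notin collision_shifts (take m w))
      (iota m (size w - m)).

(** At each level [j >= m] the letter [w`_(j - d)] is known, and the new letter must
differ from its [k] translates by collision shifts. *)
Lemma card_many_collision_shifts (p k m d a s : nat) :
  (0 < d <= m)%N -> (k <= p.+1)%N ->
  (p.+1 <= a * k)%N -> (a * s <= p.+1 - m)%N ->
  (#|[set w : p.+1.-tuple 'I_p.+1 | (k <= #|collision_shifts (take m w)|)%N &&
       avoids_shifts m d w]%SET| * 2 ^ s <= p.+1 ^ p.+1)%N.
Proof.
move=> /andP[d0 dm] kp pak asm.
(* The number of collision shifts is a condition on complete first parts only;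
   before level m nothing is required, which makes Q closed under prefixes. *)
pose Q (w : seq 'I_p.+1) :=
  ((m <= size w)%N ==> (k <= #|collision_shifts (take m w)|)%N) && avoids_shifts m d w.
have takeE (w : seq 'I_p.+1) x : (m <= size w)%N -> take m (rcons w x) = take m w.
  by move=> mw; rewrite -cats1 takel_cat.
have nthE (w : seq 'I_p.+1) x j : (j < size w)%N -> (rcons w x)`_j = w`_j.
  by move=> jw; rewrite nth_rcons jw.
have small : (0 < #|'I_p.+1|)%N by rewrite card_ord.
have Qpre (w : seq 'I_p.+1) x : Q (rcons w x) -> Q w.
  rewrite /Q /avoids_shifts size_rcons; have [mw|wm _] := leqP m (size w).
    rewrite leqW //= takeE // => /andP[-> /allP av]; apply/allP => j.
    rewrite mem_iota => jw; have := av j; rewrite mem_iota !nthE; [|lia..].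
    by apply; lia.
  by rewrite (_ : size w - m = 0)%N //; lia.
have Qm (w : seq 'I_p.+1) : (m <= size w < p.+1)%N -> Q w ->
    (#|[pred x | Q (rcons w x)]| <= #|'I_p.+1| - k)%N.
  move=> /andP[mw wp]; rewrite {1}/Q mw /= => /andP[kw _].
  (* F is the set of letters forbidden at the next position. *)
  pose F := [set w`_(size w - d) + g | g in collision_shifts (take m w)]%SET.
  have cF : #|F| = #|collision_shifts (take m w)|.
    by apply: card_imset; exact: addrI.
  have sub : [pred x | Q (rcons w x)] \subset [predC F].
    have new : size w \in iota m ((size w).+1 - m).
      by rewrite mem_iota mw subnKC ?leqnn // leqW.
    have old : (size w - d < size w)%N by lia.
    apply/fintype.subsetP => x; rewrite !inE => /andP[_ /allP].
    rewrite size_rcons takeE // => /(_ _ new); apply: contraNN.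
    by move=> /imsetP[g gG ->]; rewrite nth_rcons ltnn eqxx nthE // addrAC subrr add0r.
  apply: leq_trans (subset_leq_card sub) _.
  by rewrite -(cardC (mem F)) cF -addnBAC // leq_addl.
rewrite -[X in (_ <= X ^ _)%N](card_ord p.+1).
have := @card_halving_tree _ Q m p.+1 k a s p.+1 small Qpre Qm.
rewrite card_ord => /(_ kp pak asm (leqnn _)); apply: leq_trans; rewrite leq_mul2r.
apply/orP; right; apply: subset_leq_card; apply/fintype.subsetP => w.
by rewrite !inE /Q size_tuple; case/andP => -> ->; rewrite implybT.
Qed.

(** * Merging pairs of states *)

Definition mergeable (A : automaton) (x y : state A) : Prop :=
  exists2 w : seq {ffun state A -> state A},
    {subset w <= letters A} & word_act x w = word_act y w.

Lemma word_act_cat (Q : finType) (q : Q) (w v : seq {ffun Q -> Q}) :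
  word_act q (w ++ v) = word_act (word_act q w) v.
Proof. exact: foldl_cat. Qed.

Lemma mergeable_sym (A : automaton) (x y : state A) :
  mergeable x y -> mergeable y x.
Proof. by case=> w wA e; exists w. Qed.

Lemma mergeable_pullback (A : automaton) (x y : state A)
    (w : seq {ffun state A -> state A}) :
  {subset w <= letters A} ->
  mergeable (word_act x w) (word_act y w) -> mergeable x y.
Proof.
move=> wA [v vA e]; exists (w ++ v); last by rewrite !word_act_cat.
by move=> c; rewrite mem_cat => /orP[/wA|/vA].
Qed.

(** Merge the states one after the other: a word that is constant on some states
is extended by one that merges its value with the image of the next state. *)
Lemma synchronizes_mergeable (A : automaton) :
  (forall x y : state A, mergeable x y) -> synchronizes A.
Proof.
move=> mrg.
have mrg_seq (x : state A) (s : seq (state A)) :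
    exists2 w : seq {ffun state A -> state A}, {subset w <= letters A} &
      forall y, y \in s -> word_act y w = word_act x w.
  elim: s => [|y s [w wA ws]]; first by exists [::].
  have [v vA e] := mrg (word_act y w) (word_act x w).
  exists (w ++ v) => [c|z]; first by rewrite mem_cat => /orP[/wA|/vA].
  by rewrite inE !word_act_cat => /orP[/eqP->//|/ws->].
have [x0|noQ] := pselect (exists x : state A, True); last first.
  by exists [::]; split=> // q; case: noQ; exists q.
case: x0 => x _; have [w wA wx] := mrg_seq x (enum (state A)).
by exists w; split=> // q q'; rewrite !wx // mem_enum.
Qed.

(** Stated with [inZp] rather than a numeral because ['I_p.+1] is an additive group for
every [p], but not a nontrivial ring when [p] is 0. *)
Lemma word_act_shift (p s : nat) (x : 'I_p.+1) :
  word_act x (nseq s (circular_shift p.+1)) = x + inZp s.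
Proof.
elim: s x => [|s IHs] x.
  by apply: val_inj; rewrite /= mod0n addn0 modn_small.
rewrite /= IHs ffunE; apply: val_inj.
by rewrite /= !modnDmr modnDml addSnnS.
Qed.

Lemma mergeable_translate (p : nat) (b : {ffun 'I_p.+1 -> 'I_p.+1})
    (x y z : 'I_p.+1) :
  @mergeable (shift_automaton b) (x + z) (y + z) ->
  @mergeable (shift_automaton b) x y.
Proof.
move=> xyz.
apply: (@mergeable_pullback (shift_automaton b) _ _
  (nseq z (circular_shift p.+1))).
  by move=> c /nseqP[-> _]; rewrite !inE eqxx.
by rewrite !word_act_shift valZpK.
Qed.

Lemma mergeable_letter (p : nat) (b : {ffun 'I_p.+1 -> 'I_p.+1})
    (x y : 'I_p.+1) :
  @mergeable (shift_automaton b) (b x) (b y) ->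
  @mergeable (shift_automaton b) x y.
Proof.
move=> xy; apply: (@mergeable_pullback (shift_automaton b) _ _ [:: b]) => //.
by move=> c; rewrite !inE => ->; rewrite orbT.
Qed.

Lemma nth_mktuple_nat (p : nat) (b : {ffun 'I_p.+1 -> 'I_p.+1}) (i : nat)
    (ip : (i < p.+1)%N) : (mktuple b)`_i = b (Ordinal ip).
Proof. by rewrite -(tnth_nth 0 (mktuple b) (Ordinal ip)) tnth_mktuple. Qed.

Lemma ord_natB (p i d : nat) (ip : (i < p.+1)%N) (idp : (i - d < p.+1)%N)
    (g : 'I_p.+1) :
  g = d :> nat -> (d <= i)%N ->
  Ordinal ip = Ordinal idp + g.
Proof.
by move=> gd di; apply: val_inj; rewrite /= gd subnK // modn_small.
Qed.

(** The merging word is [a^s b a^r b]: rotate the pair to [(j - g, j)], apply [b] to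
obtain a pair whose difference is a collision shift, rotate it to a collision
of [b], and apply [b] again. *)
Lemma mergeable_avoids_shifts (p m : nat) (b : {ffun 'I_p.+1 -> 'I_p.+1})
    (x g : 'I_p.+1) :
  (m <= p.+1)%N -> (g <= m)%N -> ~~ avoids_shifts m g (mktuple b) ->
  @mergeable (shift_automaton b) x (x + g).
Proof.
move=> mp gm /allPn[j]; rewrite mem_iota size_tuple subnKC // => /andP[mj jp].
rewrite negbK => /collision_shiftsP[i].
rewrite size_takel ?size_tuple // => im.
have jg : (j - g < p.+1)%N by lia.
have ip : (i < p.+1)%N by lia.
rewrite !nth_take ?(leq_ltn_trans (leq_addr _ i) im) //.
have gj : (g <= j)%N by lia.
set h := (h in (i + nat_of_ord h)%N) in im *.
have hE : h = b (Ordinal jp) - b (Ordinal jg).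
  by rewrite /h !nth_mktuple_nat.
have ihp : (i + h < p.+1)%N by lia.
rewrite (nth_mktuple_nat b ip) (nth_mktuple_nat b ihp) => bb.
apply: (@mergeable_translate _ _ _ _ (Ordinal jg - x)).
have -> : x + (Ordinal jg - x) = Ordinal jg by rewrite addrC subrK.
have -> : x + g + (Ordinal jg - x) = Ordinal jp.
  rewrite (ord_natB jp jg (erefl (nat_of_ord g)) gj).
  by rewrite [x + g]addrC -addrA [x + _]addrCA subrr addr0 addrC.
apply: mergeable_letter.
apply: (@mergeable_translate _ _ _ _ (Ordinal ip - b (Ordinal jg))).
have -> : b (Ordinal jg) + (Ordinal ip - b (Ordinal jg)) = Ordinal ip.
  by rewrite addrC subrK.
have -> : b (Ordinal jp) + (Ordinal ip - b (Ordinal jg)) = Ordinal ihp.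
  rewrite addrCA -hE; apply: val_inj; rewrite /= modn_small //.
by apply: mergeable_letter; rewrite bb; exists [::].
Qed.

(** Of the two differences [y - x] and [x - y], one is at most half the number of
states. *)
Lemma not_synchronizes_avoids (p : nat) (b : {ffun 'I_p.+1 -> 'I_p.+1}) :
  ~ synchronizes (shift_automaton b) ->
  exists2 d : 'I_p.+1, (0 < d <= p.+1./2)%N &
    avoids_shifts p.+1./2 d (mktuple b).
Proof.
apply: contra_notP => nav; apply: synchronizes_mergeable => /= x y.
have mrg (u g : 'I_p.+1) : g != 0 -> (g <= p.+1./2)%N ->
    @mergeable (shift_automaton b) u (u + g).
  move=> g0 gh; apply: (@mergeable_avoids_shifts p p.+1./2) => //; first by lia.
  by apply/negP => av; apply: nav; exists g; rewrite // lt0n gh andbT.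
have [->|xy] := eqVneq x y; first by exists [::].
have [yxh|] := leqP (y - x)%R p.+1./2.
  have := mrg x (y - x) _ yxh; rewrite [x + _]addrC subrK; apply.
  by rewrite subr_eq0 eq_sym.
move=> yxh; apply: mergeable_sym.
have := mrg y (x - y); rewrite [y + _]addrC subrK; apply.
  by rewrite subr_eq0.
have : y - x != 0 by rewrite subr_eq0 eq_sym.
rewrite -(opprB y x); have := ltn_ord (y - x); move: (y - x) yxh => d hd dp d0.
have dpos : (0 < d)%N by rewrite lt0n.
have -> : (- d)%R = (p.+1 - d)%N :> nat by rewrite /= modn_small //; lia.
lia.
Qed.

(** * The union bound over shifts and sets of shifts *)

Lemma union_bound (I T : finType) (A : I -> {set T}) (c M : nat) :
  (forall i, #|A i| * c <= M)%N -> (#|(\bigcup_i A i)%SET| * c <= #|I| * M)%N.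
Proof.
move=> Ac; apply: (@leq_trans (\sum_i #|A i| * c)); last first.
  by rewrite -sum_nat_const leq_sum.
rewrite -big_distrl leq_mul2r; apply/orP; right.
elim/big_rec2: _ => [|i x S _ Sx]; first by rewrite cards0.
by apply: leq_trans (leq_card_setU _ _) _; rewrite leq_add2l.
Qed.

Lemma tuple_cover (T : finType) (x0 : T) (k : nat) (G : {set T}) :
  (#|G| <= k)%N -> exists t : k.-tuple T, G \subset t.
Proof.
move=> Gk; have szt : size (enum G ++ nseq (k - #|G|) x0) == k.
  by rewrite size_cat size_nseq -cardE subnKC.
exists (Tuple szt); apply/fintype.subsetP => x xG.
by suff: x \in enum G ++ nseq (k - #|G|) x0 by []; rewrite mem_cat mem_enum xG.
Qed.

(** The parameters [q a s] serve the count of words with few collision shifts, a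
union over [n^k] tuples, and [a' s'] that of words with many, a union over at
most [n] shifts [d].  Hence the requirements [n^(k+1) <= 2^s] and
[n^2 <= 2^s'], each of which leaves a spare factor [n]. *)
Lemma card_exists_avoids_shifts (p k m u q a s a' s' : nat) :
  (0 < k <= p.+1)%N -> ((q + k) * k <= u <= m)%N -> (m <= p.+1)%N ->
  (p.+1 <= a * q)%N -> (a * s <= m - u)%N -> (p.+1 ^ k.+1 <= 2 ^ s)%N ->
  (p.+1 <= a' * k)%N -> (a' * s' <= p.+1 - m)%N -> (p.+1 ^ 2 <= 2 ^ s')%N ->
  (#|[set w : p.+1.-tuple 'I_p.+1 |
       [exists d : 'I_p.+1, (0 < d <= m)%N && avoids_shifts m d w]]%SET| * p.+1
     <= 2 * p.+1 ^ p.+1)%N.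
Proof.
move=> /andP[k0 kp] qku mp paq asmu pks paq' asm' ps'.
set n := p.+1.
pose A (t : k.-tuple 'I_n) : {set n.-tuple 'I_n} :=
  [set w : n.-tuple 'I_n | collision_shifts (take m w) \subset t]%SET.
pose B (d : 'I_n) : {set n.-tuple 'I_n} :=
  if (0 < d <= m)%N then [set w : n.-tuple 'I_n |
    (k <= #|collision_shifts (take m w)|)%N && avoids_shifts m d w]%SET else finset.set0.
have cA : (#|(\bigcup_t A t)%SET| * n <= n ^ n)%N.
  have := @union_bound _ _ A (2 ^ s) (n ^ n)%N _.
  rewrite card_tuple card_ord => /(_ _)-AM.
  have nk : (0 < n ^ k)%N by rewrite expn_gt0.
  rewrite -(leq_pmul2l nk); apply: leq_trans (AM _) => [|t].
    by rewrite mulnCA -expnSr leq_mul2l pks orbT.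
  exact: (card_few_collision_shifts t k0 qku mp paq asmu).
have cB : (#|(\bigcup_d B d)%SET| * n <= n ^ n)%N.
  have := @union_bound _ _ B (2 ^ s') (n ^ n)%N _.
  rewrite card_ord => /(_ _)-BM.
  rewrite -(@leq_pmul2l n) //; apply: leq_trans (BM _) => [|d].
    by rewrite mulnCA mulnn leq_mul2l ps' orbT.
  rewrite /B; case: ifP => [dm|]; last by rewrite cards0.
  exact: (card_many_collision_shifts dm kp paq' asm').
rewrite mul2n -addnn; apply: leq_trans (leq_add cA cB); rewrite -mulnDl leq_mul2r.
apply/orP; right; apply: leq_trans (leq_card_setU _ _).
apply: subset_leq_card; apply/fintype.subsetP => w; rewrite !inE => /existsP[d /andP[dm av]].
have [kG|Gk] := leqP k #|collision_shifts (take m w)|.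
  by apply/orP; right; apply/finset.bigcupP; exists d => //; rewrite /B dm inE kG.
have [t Gt] := tuple_cover ord0 (ltnW Gk).
by apply/orP; left; apply/finset.bigcupP; exists t => //; rewrite inE.
Qed.

(** * Choice of the parameters *)

(** With [x = L %/ 4], [2 ^ L >= (2 ^ x) ^ 4 >= x.+1 ^ 4 >= (L / 4) ^ 4]; this is
where 256 comes from, and the fourth power beats [c * L ^ 3] for large [L]. *)
Lemma cube_leq_exp2 (c : nat) : exists L0, forall L, (L0 <= L)%N -> (c * L ^ 3 <= 2 ^ L)%N.
Proof.
exists (256 * c)%N => L cL.
have pow4 : (L ^ 4 <= 256 * 2 ^ L)%N.
  set x := (L %/ 4)%N.
  have xL : (L < 4 * x.+1)%N by rewrite mulnC ltn_ceil.
  apply: (@leq_trans ((4 * x.+1) ^ 4)); first by rewrite leq_exp2r // ltnW.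
  rewrite expnMn leq_mul2l; apply/orP; right.
  apply: (@leq_trans ((2 ^ x) ^ 4)); first by rewrite leq_exp2r // ltn_expl.
  by rewrite -expnM leq_exp2l // /x leq_divM.
have [->|c0] := posnP c; first by rewrite mul0n.
have L0 : (0 < L)%N by lia.
have : (256 * (c * L ^ 3) <= 256 * 2 ^ L)%N.
  by apply: leq_trans pow4; rewrite mulnA expnS leq_mul2r cL orbT.
by rewrite leq_pmul2l.
Qed.

(** [L] is the number of binary digits of [n], which plays the role of [log n]. *)
Lemma eventually_cube_log (c : nat) : exists N0, forall n, (N0 <= n)%N ->
  exists L, [/\ (0 < L)%N, (n <= 2 ^ L)%N & (c * L ^ 3 <= n)%N].
Proof.
have [L0 HL] := cube_leq_exp2 (2 * c).
exists (2 ^ L0)%N => n Nn.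
have n0 : (0 < n)%N by apply: leq_trans Nn; rewrite expn_gt0.
exists (trunc_log 2 n).+1; split=> //.
  exact/ltnW/trunc_log_ltn.
set l := trunc_log 2 n.
have ln : (2 ^ l <= n)%N by rewrite trunc_logP.
have Ll : (L0 <= l.+1)%N.
  by rewrite leqW // /l trunc_log_max.
have := HL _ Ll; rewrite [(2 ^ l.+1)%N]expnS -mulnA leq_pmul2l // => /leq_trans; exact.
Qed.

(** Parameters: [k = 8 L] shifts, the levels between [n/4] and [n/2] for the first
count and those above [n/2] for the second.  The binding constraint is
that about [n/4] levels contain [L (k + 1)] runs of [16 k] levels, which needs
[n] to exceed a multiple of [L ^ 3]. *)
Lemma card_exists_avoids_shifts_half :
  exists N0, forall p, (N0 <= p.+1)%N ->
  (#|[set w : p.+1.-tuple 'I_p.+1 |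
       [exists d : 'I_p.+1, (0 < d <= p.+1./2)%N &&
          avoids_shifts p.+1./2 d w]]%SET| * p.+1
     <= 2 * p.+1 ^ p.+1)%N.
Proof.
have [N0 HN] := eventually_cube_log (9 * 8 * 8 * 9).
exists N0 => p /HN[L [L0 pL cL]].
have L23 : (L <= L ^ 2 <= L ^ 3)%N by rewrite !expnS expn0; nia.
have [k kE] : exists k, (k = 8 * L)%N by exists (8 * L)%N.
pose q := (p.+1 %/ (8 * k))%N.
have qk : (q * (8 * k) <= p.+1)%N by exact: leq_divM.
have qk1 : (p.+1 < q.+1 * (8 * k))%N by rewrite ltn_ceil // muln_gt0; lia.
have bk : (p.+1 %/ k * k <= p.+1)%N by exact: leq_divM.
have bk1 : (p.+1 < (p.+1 %/ k).+1 * k)%N by rewrite ltn_ceil; lia.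
have q0 : (0 < q)%N by rewrite lt0n; apply/eqP => qE; rewrite qE kE in qk1; lia.
move: q qk qk1 q0 => q qk qk1 q0.
have half : (p.+1./2 + p.+1./2 <= p.+1 <= p.+1./2 + p.+1./2 + 1)%N by lia.
have quarter : (4 * (p.+1 %/ 4) <= p.+1 <= 4 * (p.+1 %/ 4) + 3)%N by lia.
have LLL : (L ^ 3 = L * L * L)%N by rewrite !expnS expn0; lia.
have LL : (L ^ 2 = L * L)%N by rewrite !expnS expn0; lia.
apply: (@card_exists_avoids_shifts p k _ (p.+1 %/ 4) q (16 * k) (L * k.+1)
   (p.+1 %/ k).+1 (L * 2)).
- lia.
- move: (p.+1./2) (p.+1 %/ 4)%N half quarter => h r half quarter.
  rewrite {}kE in qk qk1 *; apply/andP; split; last by lia.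
  have : (q * (8 * (8 * L)) = 8 * (q * (8 * L)))%N by lia.
  rewrite mulnDl; have -> : (8 * L * (8 * L) = 64 * L ^ 2)%N by lia.
  lia.
- lia.
- nia.
- have -> : (16 * k * (L * k.+1) = 1024 * L ^ 3 + 128 * L ^ 2)%N by rewrite kE; nia.
  lia.
- by rewrite expnM leq_exp2r.
- exact: ltnW.
- nia.
- by rewrite expnM leq_exp2r.
Qed.

(** * The probability of synchronization *)

Lemma card_not_synchronizes_le (p : nat) :
  (#|[set b : {ffun 'I_p.+1 -> 'I_p.+1} |
       ~~ `[< synchronizes (shift_automaton b) >]]%SET|
   <= #|[set w : p.+1.-tuple 'I_p.+1 |
          [exists d : 'I_p.+1, (0 < d <= p.+1./2)%N &&
             avoids_shifts p.+1./2 d w]]%SET|)%N.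
Proof.
pose word (b : {ffun 'I_p.+1 -> 'I_p.+1}) := mktuple b.
have word_inj : injective word.
  move=> b c /(congr1 (@tnth _ _)) bc; apply/ffunP => i.
  by have := congr1 (@^~ i) bc; rewrite !tnth_mktuple.
rewrite -(card_imset _ word_inj); apply: subset_leq_card; apply/fintype.subsetP.
move=> _ /imsetP[b + ->]; rewrite !inE => /asboolPn/not_synchronizes_avoids[d dh av].
by apply/existsP; exists d; rewrite dh.
Qed.

Lemma sync_prob_compl (R : realType) (p : nat) :
  1 - sync_prob R p.+1 =
  #|[set b : {ffun 'I_p.+1 -> 'I_p.+1} |
      ~~ `[< synchronizes (shift_automaton b) >]]%SET|%:R / (p.+1 ^ p.+1)%:R.
Proof.
have T0 : (p.+1 ^ p.+1)%:R != 0 :> R by rewrite pnatr_eq0 -lt0n expn_gt0.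
rewrite /sync_prob /unif_prob card_ffun !card_ord -[X in X - _](divff T0) -mulrBl.
congr (_ / _).
set S := [set b : {ffun _} | `[< synchronizes _ >]]%SET.
have -> : [set b : {ffun 'I_p.+1 -> 'I_p.+1} |
      ~~ `[< synchronizes (shift_automaton b) >]]%SET = (~: S)%SET.
  by apply/setP => b; rewrite !inE.
have := cardsC S; rewrite card_ffun !card_ord => <-.
by rewrite natrD addrC addKr.
Qed.

Lemma sync_prob_bound (R : realType) :
  \forall n \near \oo, `|sync_prob R n - 1| <= 2 / n%:R.
Proof.
have [N0 HN] := card_exists_avoids_shifts_half.
exists N0.+1 => // -[//|p] /= pN.
have n0 : 0 < p.+1%:R :> R by rewrite ltr0n.
have nn0 : 0 < (p.+1 ^ p.+1)%:R :> R by rewrite ltr0n expn_gt0.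
rewrite distrC sync_prob_compl ger0_norm ?divr_ge0 ?ler0n //.
rewrite ler_pdivrMr // mulrAC ler_pdivlMr // -natrM -natrM ler_nat.
apply: leq_trans (HN p (ltnW pN)).
by rewrite leq_mul2r card_not_synchronizes_le orbT.
Qed.

Theorem theorem4 (R : realType) :
  (sync_prob R = cst 1 +O_\oo (fun n : nat => n%:R^-1 : R)) /\
  (sync_prob R n @[n --> \oo] --> (1 : R)).
Proof.
have bound := sync_prob_bound R.
split.
  apply/eqaddOP; near=> k; near=> n.
  rewrite /cst /=.
  have n2 : `|sync_prob R n - 1| <= 2 / n%:R by near: n.
  apply: le_trans n2 _; rewrite [leRHS]/( _ * `|n%:R^-1| ) ger0_norm ?invr_ge0 //.
  by rewrite ler_wpM2r ?invr_ge0 //; near: k; apply: nbhs_pinfty_ge; rewrite num_real.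
apply/subr_cvg0.
apply/norm_cvg0P.
apply: (@squeeze_cvgr _ _ _ _ (cst 0) (fun n => 2 * n%:R^-1)).
- by near=> n; rewrite normr_ge0 /=; near: n.
- exact: cvg_cst.
- rewrite -[X in _ --> X](mulr0 2); apply: cvgMr.
  rewrite -(@cvg_shiftS _ (fun n : nat => n%:R^-1 : R)); exact: cvg_harmonic.
Unshelve. all: by end_near.
Qed.
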